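(* Let $R$ be a commutative ring with unity, let $M$ be an $R$-module, let $N$ be a Noetherian $R$-module, and let $F$ be an $R$-submodule of $\operatorname{Hom}_R(N,M)$. Then the following statements hold: (1) $\operatorname{inj}^F_R(M,N)=\inf\{\operatorname{inj}^{F_{\mathfrak p}}_{R_{\mathfrak p}}(M_{\mathfrak p},N_{\mathfrak p}):\mathfrak p\in\operatorname{Ass}_R(N)\}$. (2) $\operatorname{cog}^F_R(N,M)=\sup\{\operatorname{cog}^{F_{\mathfrak p}}_{R_{\mathfrak p}}(N_{\mathfrak p},M_{\mathfrak p}):\mathfrak p\in\operatorname{Ass}_R(N)\}$. (3) $F$ contains an injection if and only if $F_{\mathfrak p}$ contains an injection for every $\mathfrak p\in\operatorname{Ass}_R(N)$. Moreover, in each of the three statements above, $\operatorname{Ass}_R(N)$ can be replaced with the set consisting of just the maximal members (with respect to inclusion) of $\operatorname{Ass}_R(N)$.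
   Context: For a prime $\mathfrak p$ of $R$, $\operatorname{Soc}_{R_{\mathfrak p}}(N_{\mathfrak p})$ is the set of elements of $N_{\mathfrak p}$ annihilated by $\mathfrak p_{\mathfrak p}=\mathfrak pR_{\mathfrak p}$, and $\operatorname{Ass}_R(N)$ is the (finite) set of primes $\mathfrak p$ of $R$ with $\operatorname{Soc}_{R_{\mathfrak p}}(N_{\mathfrak p})\neq 0$. For an $R$-module $L$ and an integer $t\ge 0$, $L^{\oplus t}$ is the direct sum of $t$ copies of $L$, with $L^{\oplus 0}=0$. For an $R$-submodule $F\subseteq\operatorname{Hom}_R(N,M)$: writing $F^{\oplus t}\subseteq\operatorname{Hom}_R(N^{\oplus t},M)$ means the maps given by rows $(f_1,\dots,f_t)$, i.e. $(x_1,\dots,x_t)\mapsto\sum_j f_j(x_j)$, with all $f_j\in F$; writing $F^{\oplus t}\subseteq\operatorname{Hom}_R(N,M^{\oplus t})$ means the maps given by columns $(f_1,\dots,f_t)^{\top}$, i.e. $x\mapsto (f_1(x),\dots,f_t(x))$, with all $f_j\in F$. $\operatorname{inj}^F_R(M,N)$ (the global injective capacity of $M$ with respect to $N$ over $R$ when restricted to $F$) is the supremum of the integers $t\ge 0$ for which there is an injection in $F^{\oplus t}\subseteq\operatorname{Hom}_R(N^{\oplus t},M)$. $\operatorname{cog}^F_R(N,M)$ (the global number of cogenerators of $N$ with respect to $M$ over $R$ when restricted to $F$) is the infimum of the integers $t\ge 0$ for which there is an injection in $F^{\oplus t}\subseteq\operatorname{Hom}_R(N,M^{\oplus t})$. Conventions: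 $\sup(\varnothing)=0$, $\sup(\{0,1,2,\dots\})=\infty$, $\inf(\varnothing)=\infty$, $\inf(\{0,1,2,\dots\})=0$. For a prime $\mathfrak p$, $F_{\mathfrak p}$ is the localization of $F$ at $\mathfrak p$, viewed inside $\operatorname{Hom}_{R_{\mathfrak p}}(N_{\mathfrak p},M_{\mathfrak p})$ by letting $f/s$ act as $\frac1s f_{\mathfrak p}$; the local invariants $\operatorname{inj}^{F_{\mathfrak p}}_{R_{\mathfrak p}}(M_{\mathfrak p},N_{\mathfrak p})$ and $\operatorname{cog}^{F_{\mathfrak p}}_{R_{\mathfrak p}}(N_{\mathfrak p},M_{\mathfrak p})$ are defined by the same definitions over $R_{\mathfrak p}$ with $F_{\mathfrak p}$ in place of $F$. *)

(* Defs.v *)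
From HB Require Import structures.
From mathcomp Require Import all_boot all_order all_algebra generic_quotient.
From mathcomp Require Import all_classical all_reals.
From mathcomp Require Import ring.
Set Implicit Arguments.
Unset Strict Implicit.
Unset Printing Implicit Defensive.
Import Order.TTheory GRing.Theory.
Local Open Scope classical_set_scope.
Local Open Scope quotient_scope.
Local Open Scope ring_scope.

Section Submodules.
Variables (R : pzRingType) (L : lmodType R).

Definition submodule (A : set L) : Prop := submod_closed [in A].

Definition noetherian_module : Prop :=
  forall U : nat -> set L,
    (forall n, submodule (U n)) -> (forall n, U n `<=` U n.+1) ->
    exists n, forall m, (n <= m)%N -> U m = U n.

End Submodules.

(** [Hom_R(U, V)] is the type [{linear U -> V}]; over a commutative ring it is
    an [R]-module for the pointwise operations. *)
Section HomModule.
Variables (R : comPzRingType) (U V : lmodType R).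
Implicit Types f g h : {linear U -> V}.

Lemma linear_ext f g : f =1 g -> f = g.
Proof.
case: f => f [[f1] [f2]]; case: g => g [[g1] [g2]] /= /funext fg.
subst g; congr GRing.Linear.Pack.
by congr GRing.Linear.Class; [congr GRing.isNmodMorphism.Axioms_
  | congr GRing.isScalable.Axioms_]; exact: Prop_irrelevance.
Qed.

Definition hom_zero : {linear U -> V} := \0.
Definition hom_add f g : {linear U -> V} := f \+ g.
Definition hom_opp f : {linear U -> V} := \- f.
Definition hom_scale (a : R) f : {linear U -> V} := a \*: f.

Fact hom_addA : associative hom_add.
Proof. by move=> f g h; apply: linear_ext => x /=; rewrite addrA. Qed.
Fact hom_addC : commutative hom_add.
Proof. by move=> f g; apply: linear_ext => x /=; rewrite addrC. Qed.
Fact hom_add0 : left_id hom_zero hom_add.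
Proof. by move=> f; apply: linear_ext => x /=; rewrite add0r. Qed.
Fact hom_addN : left_inverse hom_zero hom_opp hom_add.
Proof. by move=> f; apply: linear_ext => x /=; rewrite addNr. Qed.

HB.instance Definition _ :=
  GRing.isZmodule.Build {linear U -> V} hom_addA hom_addC hom_add0 hom_addN.

Fact hom_scaleA a b f : hom_scale a (hom_scale b f) = hom_scale (a * b) f.
Proof. by apply: linear_ext => x /=; rewrite scalerA. Qed.
Fact hom_scale1 : left_id 1 hom_scale.
Proof. by move=> f; apply: linear_ext => x /=; rewrite scale1r. Qed.
Fact hom_scaleDr : right_distributive hom_scale +%R.
Proof. by move=> a f g; apply: linear_ext => x /=; rewrite scalerDr. Qed.
Fact hom_scaleDl f : {morph hom_scale^~ f : a b / a + b}.
Proof. by move=> a b; apply: linear_ext => x /=; rewrite scalerDl. Qed.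

HB.instance Definition _ := GRing.Zmodule_isLmodule.Build R {linear U -> V}
  hom_scaleA hom_scale1 hom_scaleDr hom_scaleDl.

End HomModule.

Record is_prime_ideal (R : comPzRingType) (P : set R) : Prop := IsPrimeIdeal {
  prime_ideal0 : P 0;
  prime_idealD : forall a b, P a -> P b -> P (a + b);
  prime_idealMl : forall a b, P b -> P (a * b);
  prime_ideal1 : ~ P 1;
  prime_idealM : forall a b, P (a * b) -> P a \/ P b }.

Record prime_spec (R : comPzRingType) := PrimeSpec {
  prime_set :> set R;
  prime_setP : is_prime_ideal prime_set }.

(** The denominators allowed in the localization at [p], i.e. the elements of
    [R] outside [p]. *)
Definition den (R : comPzRingType) (p : prime_spec R) := set_type (~` p).

Section Denominators.
Variables (R : comPzRingType) (p : prime_spec R).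
Implicit Types s t : den p.

HB.instance Definition _ := Choice.on (den p).

Definition den_val s : R := \val s.

Lemma denP s : ~ prime_set p (den_val s).
Proof. by have /set_mem := valP s. Qed.

Lemma den_inj : injective den_val. Proof. exact: val_inj. Qed.

Fact den1_subproof : (1 : R) \in ~` p.
Proof. by rewrite inE /=; exact: prime_ideal1 (prime_setP p). Qed.
Definition den1 : den p := Sub (1 : R) den1_subproof.

Fact denM_subproof s t : den_val s * den_val t \in ~` p.
Proof.
by rewrite inE /= => /(prime_idealM (prime_setP p)) [/denP|/denP].
Qed.
Definition denM s t : den p := Sub (den_val s * den_val t) (denM_subproof s t).

Lemma den_valM s t : den_val (denM s t) = den_val s * den_val t.
Proof. by []. Qed.
Lemma den_val1 : den_val den1 = 1. Proof. by []. Qed.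

End Denominators.

Arguments den_val : simpl never.

(** The localization [L_p]: pairs [(x, s)] with [s] outside [p], where
    [(x, s) ~ (y, t)] when [u t x = u s y] for some [u] outside [p]. *)
Section Localization.
Variables (R : comPzRingType) (p : prime_spec R) (L : lmodType R).
Implicit Types (x y z : L) (s t u : den p).

Definition loc_rel (a b : L * den p) : bool :=
  `[< exists u : den p,
        den_val u *: (den_val b.2 *: a.1)
        = den_val u *: (den_val a.2 *: b.1) >].

Lemma loc_rel_refl : reflexive loc_rel.
Proof. by move=> a; apply/asboolP; exists (den1 p). Qed.

Lemma loc_rel_sym : symmetric loc_rel.
Proof.
suff H a b : loc_rel a b -> loc_rel b a by move=> a b; apply/idP/idP; apply: H.
by move=> /asboolP[u uE]; apply/asboolP; exists u.
Qed.

Lemma loc_rel_trans : transitive loc_rel.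
Proof.
move=> [y t] [x s] [z r] /asboolP[/= u uE] /asboolP[/= v vE].
apply/asboolP; exists (denM (denM u v) t) => /=.
rewrite !den_valM !scalerA in uE vE *.
have -> : den_val u * den_val v * den_val t * den_val r
  = den_val v * den_val r * (den_val u * den_val t).
  by ring.
rewrite -scalerA uE scalerA.
have -> : den_val v * den_val r * (den_val u * den_val s)
  = den_val u * den_val s * (den_val v * den_val r).
  by ring.
rewrite -scalerA vE scalerA; congr (_ *: _); ring.
Qed.

Canonical loc_equiv := EquivRel loc_rel loc_rel_refl loc_rel_sym loc_rel_trans.

Definition loc := {eq_quot loc_rel}.

HB.instance Definition _ := Choice.on loc.

Definition lfrac x s : loc := \pi_loc (x, s).

Lemma lfracP (a : loc) : exists x s, a = lfrac x s.
Proof.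
by case: (repr a) (reprK a) => x s <-; exists x, s.
Qed.

Lemma eq_lfrac x s y t :
  lfrac x s = lfrac y t <->
  exists u : den p,
    den_val u *: (den_val t *: x) = den_val u *: (den_val s *: y).
Proof.
split=> [/eqmodP/asboolP//|e]; exact/eqmodP/asboolP.
Qed.

Definition loc_zero : loc := lfrac 0 (den1 p).
Definition loc_add (a b : loc) : loc :=
  let: (x, s) := repr a in let: (y, t) := repr b in
  lfrac (den_val t *: x + den_val s *: y) (denM s t).
Definition loc_opp (a : loc) : loc := let: (x, s) := repr a in lfrac (- x) s.

Lemma repr_lfrac x s : exists y t, repr (lfrac x s) = (y, t) /\
  exists u : den p,
    den_val u *: (den_val t *: x) = den_val u *: (den_val s *: y).
Proof.
case e: (repr (lfrac x s)) => [y t]; exists y, t; split=> //.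
by apply/eq_lfrac; rewrite -[LHS]reprK e.
Qed.

Lemma loc_addE x s y t :
  loc_add (lfrac x s) (lfrac y t)
  = lfrac (den_val t *: x + den_val s *: y) (denM s t).
Proof.
rewrite /loc_add.
have [x' [s' [-> [u uE]]]] := repr_lfrac x s.
have [y' [t' [-> [v vE]]]] := repr_lfrac y t.
apply/eq_lfrac; exists (denM u v); rewrite !den_valM.
rewrite !scalerDr !scalerA in uE vE *.
congr (_ + _).
- rewrite [X in X *: _](_ :
    _ = den_val v * den_val t * den_val t' * (den_val u * den_val s)).
    rewrite -[LHS]scalerA -uE scalerA; congr (_ *: _); ring.
  by ring.
- rewrite [X in X *: _](_ :
    _ = den_val u * den_val s * den_val s' * (den_val v * den_val t)).
    rewrite -[LHS]scalerA -vE scalerA; congr (_ *: _); ring.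
  by ring.
Qed.

Lemma loc_oppE x s : loc_opp (lfrac x s) = lfrac (- x) s.
Proof.
rewrite /loc_opp; have [x' [s' [-> [u uE]]]] := repr_lfrac x s.
by apply/eq_lfrac; exists u; rewrite !scalerN uE.
Qed.

Lemma lfrac_cancel u x s : lfrac (den_val u *: x) (denM u s) = lfrac x s.
Proof.
apply/eq_lfrac; exists (den1 p).
by rewrite ?(den_valM, den_val1) !scalerA; congr (_ *: _); ring.
Qed.

Fact loc_addA : associative loc_add.
Proof.
move=> a b c; have [x [s ->]] := lfracP a; have [y [t ->]] := lfracP b.
have [z [r ->]] := lfracP c; rewrite !loc_addE.
apply/eq_lfrac; exists (den1 p).
rewrite ?(den_valM, den_val1) !scalerDr !scalerA addrA.
by congr (_ *: _ + _ *: _ + _ *: _); ring.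
Qed.

Fact loc_addC : commutative loc_add.
Proof.
move=> a b; have [x [s ->]] := lfracP a; have [y [t ->]] := lfracP b.
rewrite !loc_addE; apply/eq_lfrac; exists (den1 p).
rewrite ?(den_valM, den_val1) !scalerDr !scalerA addrC.
by congr (_ *: _ + _ *: _); ring.
Qed.

Fact loc_add0 : left_id loc_zero loc_add.
Proof.
move=> a; have [x [s ->]] := lfracP a; rewrite loc_addE.
apply/eq_lfrac; exists (den1 p).
by rewrite ?(den_valM, den_val1) scaler0 add0r !scalerA; congr (_ *: _); ring.
Qed.

Fact loc_addN : left_inverse loc_zero loc_opp loc_add.
Proof.
move=> a; have [x [s ->]] := lfracP a; rewrite loc_oppE loc_addE.
by apply/eq_lfrac; exists (den1 p); rewrite scalerN addNr !scaler0.
Qed.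

HB.instance Definition _ :=
  GRing.isZmodule.Build loc loc_addA loc_addC loc_add0 loc_addN.

Lemma lfracD x s y t :
  lfrac x s + lfrac y t = lfrac (den_val t *: x + den_val s *: y) (denM s t).
Proof. exact: loc_addE. Qed.

Lemma lfracN x s : - lfrac x s = lfrac (- x) s.
Proof. exact: loc_oppE. Qed.

Lemma lfrac0 s : lfrac 0 s = 0.
Proof.
by apply/eq_lfrac; exists s; rewrite !scaler0.
Qed.

End Localization.

Arguments lfrac {R} p {L} x s : assert.

(** The ring [R_p]: the localization of [R] as a module over itself, with
    multiplication [(a / s) (b / t) = a b / s t]. *)
Section LocalRing.
Variables (R : comPzRingType) (p : prime_spec R).
Implicit Types (a b : R) (s t u : den p).

Definition loc_ring := loc p R^o.

HB.instance Definition _ := GRing.Zmodule.on loc_ring.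

Definition rfrac a s : loc_ring := lfrac p (a : R^o) s.

Lemma rfracP (k : loc_ring) : exists a s, k = rfrac a s.
Proof. exact: (@lfracP R p R^o k). Qed.

Lemma rfracD a s b t :
  rfrac a s + rfrac b t
  = rfrac (den_val t * a + den_val s * b) (denM s t).
Proof. exact: (@lfracD R p R^o a s b t). Qed.

Definition loc_one : loc_ring := rfrac 1 (den1 p).

End LocalRing.

Section LocalScale.
Variables (R : comPzRingType) (p : prime_spec R) (L : lmodType R).
Implicit Types (a b : R) (x y : L) (s t u : den p).

Definition loc_scale (k : loc_ring p) (m : loc p L) : loc p L :=
  let: (a, s) := repr k in let: (x, t) := repr m in
  lfrac p (a *: x) (denM s t).

Lemma loc_scaleE a s x t :
  loc_scale (rfrac a s) (lfrac p x t) = lfrac p (a *: x) (denM s t).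
Proof.
rewrite /loc_scale /rfrac.
have [a' [s' [-> [u uE]]]] := repr_lfrac (a : R^o) s.
have [x' [t' [-> [v vE]]]] := repr_lfrac x t.
apply/eq_lfrac; exists (denM u v); rewrite !den_valM.
have {}uE : den_val u * (den_val s' * a) = den_val u * (den_val s * a') := uE.
rewrite !scalerA in vE *.
rewrite [X in X *: _](_ :
    _ = den_val u * den_val s * a' * (den_val v * den_val t)); last by ring.
rewrite -scalerA -vE scalerA.
rewrite [X in X *: _](_ :
    _ = den_val u * (den_val s * a') * (den_val v * den_val t')); last by ring.
by rewrite -uE; congr (_ *: _); ring.
Qed.

Lemma loc_scale1 : left_id (loc_one p) loc_scale.
Proof.
move=> m; have [x [t ->]] := lfracP m; rewrite loc_scaleE.
apply/eq_lfrac; exists (den1 p).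
by rewrite ?(den_valM, den_val1) !scalerA; congr (_ *: _); ring.
Qed.

Lemma loc_scaleDr : right_distributive loc_scale +%R.
Proof.
move=> k m n; have [a [s ->]] := rfracP k; have [x [t ->]] := lfracP m.
have [y [r ->]] := lfracP n; rewrite lfracD !loc_scaleE lfracD.
apply/eq_lfrac; exists (den1 p).
rewrite ?(den_valM, den_val1) !scalerDr !scalerA.
by congr (_ *: _ + _ *: _); ring.
Qed.

Lemma loc_scaleDl m : {morph loc_scale^~ m : k l / k + l}.
Proof.
move=> k l; have [a [s ->]] := rfracP k; have [b [r ->]] := rfracP l.
have [x [t ->]] := lfracP m.
rewrite rfracD !loc_scaleE lfracD.
apply/eq_lfrac; exists (den1 p).
rewrite ?(den_valM, den_val1) !scalerDr !scalerA -scalerDl.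
by congr (_ *: _); ring.
Qed.

End LocalScale.

Section LocalRingTheory.
Variables (R : comPzRingType) (p : prime_spec R).
Implicit Types (a b : R) (s t u : den p).

Definition loc_mul (k l : loc_ring p) : loc_ring p := loc_scale k l.

Lemma loc_mulE a s b t :
  loc_mul (rfrac a s) (rfrac b t) = rfrac (a * b) (denM s t).
Proof. exact: loc_scaleE. Qed.

Fact loc_mulC : commutative loc_mul.
Proof.
move=> k l; have [a [s ->]] := rfracP k; have [b [t ->]] := rfracP l.
rewrite !loc_mulE mulrC; congr rfrac.
by apply: den_inj; rewrite !den_valM mulrC.
Qed.

Fact loc_mulA : associative loc_mul.
Proof.
move=> k l m; have [a [s ->]] := rfracP k; have [b [t ->]] := rfracP l.
have [c [r ->]] := rfracP m.
rewrite !loc_mulE mulrA; congr rfrac.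
by apply: den_inj; rewrite !den_valM mulrA.
Qed.

Fact loc_mul1 : left_id (loc_one p) loc_mul.
Proof. exact: loc_scale1. Qed.

Fact loc_mulDl : left_distributive loc_mul +%R.
Proof. by move=> k l m; exact: loc_scaleDl. Qed.

HB.instance Definition _ := GRing.Zmodule_isComPzRing.Build (loc_ring p)
  loc_mulA loc_mulC loc_mul1 loc_mulDl.

Lemma rfracM a s b t : rfrac a s * rfrac b t = rfrac (a * b) (denM s t).
Proof. exact: loc_mulE. Qed.

End LocalRingTheory.

Section LocalModule.
Variables (R : comPzRingType) (p : prime_spec R) (L : lmodType R).

Fact loc_scaleA (k l : loc_ring p) (m : loc p L) :
  loc_scale k (loc_scale l m) = loc_scale (k * l) m.
Proof.
have [a [s ->]] := rfracP k; have [b [t ->]] := rfracP l.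
have [x [r ->]] := lfracP m.
rewrite rfracM !loc_scaleE scalerA; congr lfrac.
by apply: den_inj; rewrite !den_valM mulrA.
Qed.

HB.instance Definition _ := GRing.Zmodule_isLmodule.Build (loc_ring p) (loc p L)
  (@loc_scaleA) (@loc_scale1 R p L) (@loc_scaleDr R p L) (@loc_scaleDl R p L).

Lemma lfracZ a s x t :
  (rfrac a s : loc_ring p) *: lfrac p x t
  = lfrac p (a *: x) (denM s t) :> loc p L.
Proof. exact: loc_scaleE. Qed.

End LocalModule.

Section LocalHom.
Variables (R : comPzRingType) (p : prime_spec R) (N M : lmodType R).

(** [f_p (x / s) = f x / s]. *)
Definition loc_map (f : {linear N -> M}) (a : loc p N) : loc p M :=
  let: (x, s) := repr a in lfrac p (f x) s.

Lemma loc_mapE f x s : loc_map f (lfrac p x s) = lfrac p (f x) s.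
Proof.
rewrite /loc_map; have [x' [s' [-> [u uE]]]] := repr_lfrac x s.
apply/eq_lfrac; exists u.
by have := congr1 f uE; rewrite !(linearZZ f).
Qed.

Fact loc_map_is_linear f : linear (loc_map f).
Proof.
move=> k a b; have [c [r ->]] := rfracP k.
have [x [s ->]] := lfracP a; have [y [t ->]] := lfracP b.
by rewrite lfracZ lfracD !loc_mapE lfracZ lfracD (linearD f) !(linearZZ f).
Qed.

HB.instance Definition _ f := GRing.isLinear.Build (loc_ring p) (loc p N)
  (loc p M) *:%R (loc_map f) (loc_map_is_linear f).

Definition loc_hom f : {linear loc p N -> loc p M} := loc_map f.

(** [F_p] inside [Hom_{R_p}(N_p, M_p)]: the maps [(1 / s) f_p] with [f] in [F]
    and [s] outside [p]. *)
Definition loc_homs (F : set {linear N -> M}) :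
    set {linear loc p N -> loc p M} :=
  [set g | exists f (s : den p),
     F f /\ g = rfrac 1 s *: loc_hom f].

End LocalHom.

Arguments loc_homs {R} p {N M} F _ : assert.

Section AssociatedPrimes.
Variables (R : comPzRingType) (N : lmodType R).

(** The ideal [p R_p] of [R_p]. *)
Definition loc_ideal (p : prime_spec R) : set (loc_ring p) :=
  [set k | exists a (s : den p), prime_set p a /\ k = rfrac a s].
Arguments loc_ideal : clear implicits.

Definition socle (p : prime_spec R) : set (loc p N) :=
  [set m | forall k : loc_ring p, loc_ideal p k -> k *: m = 0].
Arguments socle : clear implicits.

Definition Ass : set (prime_spec R) := [set p | socle p <> [set 0]].

Definition maxAss : set (prime_spec R) :=
  [set p | Ass p /\ forall q, Ass q -> p `<=` q -> q = p :> set R].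

End AssociatedPrimes.

Arguments loc_ideal {R} p k : assert.
Arguments socle {R} N p m : assert.
Arguments Ass {R} N p : assert.
Arguments maxAss {R} N p : assert.

Section Invariants.
Variables (R : comPzRingType) (N M : lmodType R) (F : set {linear N -> M}).

Section Maps.
Variables (t : nat) (f : 'I_t -> {linear N -> M}).

Definition row_map (x : {ffun 'I_t -> N}) : M := \sum_j f j (x j).
Definition col_map (x : N) : {ffun 'I_t -> M} := [ffun j => f j x].

Fact row_map_is_linear : linear row_map.
Proof.
move=> a x y; rewrite /row_map scaler_sumr -big_split /=.
by apply: eq_bigr => j _; rewrite !ffunE linearP.
Qed.
HB.instance Definition _ := GRing.isLinear.Build R {ffun 'I_t -> N} M *:%R
  row_map row_map_is_linear.

Fact col_map_is_linear : linear col_map.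
Proof. by move=> a x y; apply/ffunP => j; rewrite !ffunE linearP. Qed.
HB.instance Definition _ := GRing.isLinear.Build R N {ffun 'I_t -> M} *:%R
  col_map col_map_is_linear.

Definition row_hom : {linear {ffun 'I_t -> N} -> M} := row_map.
Definition col_hom : {linear N -> {ffun 'I_t -> M}} := col_map.

End Maps.

Definition row_homs t : set {linear {ffun 'I_t -> N} -> M} :=
  [set g | exists f : 'I_t -> {linear N -> M},
     (forall j, F (f j)) /\ g = row_hom f].

Definition col_homs t : set {linear N -> {ffun 'I_t -> M}} :=
  [set g | exists f : 'I_t -> {linear N -> M},
     (forall j, F (f j)) /\ g = col_hom f].

Definition has_injection (U V : lmodType R) (G : set {linear U -> V}) : Prop :=
  exists2 g, G g & injective g.

(** Both invariants are extended naturals, taken in [\bar int]; the first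
    argument of [supremum] and [infimum] is the value at the empty set. *)
Definition inj_capacity : \bar int :=
  supremum 0%E
    [set t%:Z%:E | t in [set t : nat | has_injection (@row_homs t)]].

Definition num_cogenerators : \bar int :=
  infimum +oo%E
    [set t%:Z%:E | t in [set t : nat | has_injection (@col_homs t)]].

End Invariants.

Arguments row_homs {R N M} F t g : assert.
Arguments col_homs {R N M} F t g : assert.

(* Main.v *)
Require Import Defs.
From HB Require Import structures.
From mathcomp Require Import all_boot all_order all_algebra.
From mathcomp Require Import all_classical all_reals.
From mathcomp Require Import ring.
Set Implicit Arguments.
Unset Strict Implicit.
Unset Printing Implicit Defensive.
Import Order.TTheory GRing.Theory Num.Theory.
Local Open Scope classical_set_scope.
Local Open Scope ring_scope.

(** Everything reduces to one statement about a Noetherian module [L] (which is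
    [N^t] for the injective capacity and [N] for the cogenerators), a module
    [L'] and a submodule [G] of [Hom(L, L')]: if for every maximal associated
    prime [p] of [L] some element of [G] is injective at [p], then [G] contains
    an injection.

    Injectivity of [g] on [L] only has to be tested on the elements whose
    annihilator is an associated prime. One starts with the sum of the
    [r_i f_i], where [f_i] is injective at the [i]-th maximal associated prime
    and [r_i] lies in all the other ones but not in that one; this handles the
    maximal associated primes. The remaining associated primes [q] are added in
    decreasing order, replacing [g] by [g + r f] with [r] in all the primes
    already handled but not in [q], and [f] injective at [q]. As [q] is strictly
    contained in another prime, [R / q] is a domain that is not a field, which
    leaves infinitely many values of [r] modulo [q]; only finitely many of them
    can fail, because the corresponding kernels are independent, like
    eigenspaces for distinct eigenvalues. *)

(** * Consequences of the ascending chain condition *)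

Section NoetherianModules.
Variables (R : comPzRingType) (L : lmodType R).
Hypothesis noethL : noetherian_module L.

Lemma submoduleP (A : set L) :
  submodule A <-> A 0 /\ forall a x y, A x -> A y -> A (a *: x + y).
Proof.
split=> [[/[!inE] A0 Al]|[A0 Al]].
  by split=> // a x y Ax Ay; apply/set_mem/Al; exact/mem_set.
by split=> [|a x y]; rewrite !inE //; exact: Al.
Qed.

(** The spans of the first [n] terms form a chain; where it stops growing, [x n] is a combination of
    its predecessors. The coefficient 1 will contradict its membership in a prime. *)
Lemma noetherian_dependence (x : nat -> L) :
  exists n (c : nat -> R), c n = 1 /\ \sum_(i < n.+1) c i *: x i = 0.
Proof.
pose U n := [set y | exists c : nat -> R, y = \sum_(i < n) c i *: x i].
have Usub n : submodule (U n).
  apply/submoduleP; split=> [|a _ _ [c ->] [d ->]].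
    by exists (fun=> 0); rewrite big1 // => i _; rewrite scale0r.
  exists (fun i => a * c i + d i); rewrite scaler_sumr -big_split /=.
  by apply: eq_bigr => i _; rewrite scalerDl scalerA.
have Uinc n : U n `<=` U n.+1.
  move=> _ [c ->]; exists (fun i => if i == n then 0 else c i).
  rewrite big_ord_recr /= eqxx scale0r addr0.
  by apply: eq_bigr => i _; rewrite ltn_eqF.
have [n Un] := noethL Usub Uinc.
have : U n.+1 (x n).
  exists (fun i => if i == n then 1 else 0).
  rewrite big_ord_recr /= eqxx scale1r big1 ?add0r // => i _.
  by rewrite ltn_eqF // scale0r.
rewrite Un // => -[c xE]; exists n, (fun i => if i == n then 1 else - c i).
rewrite eqxx; split=> //; rewrite big_ord_recr /= eqxx scale1r {1}xE -big_split.
by rewrite big1 // => i _; rewrite ltn_eqF //= scaleNr addNr.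
Qed.

(** Otherwise choice gives each member a strictly larger one, and iterating yields a chain that
    never stabilises. *)
Lemma noetherian_maximal (T : Type) (U : T -> set L) (A : set T) :
  (forall i, submodule (U i)) -> A !=set0 ->
  exists2 i, A i & forall j, A j -> U i `<=` U j -> U j `<=` U i.
Proof.
move=> Usub [i0 Ai0]; apply: contrapT => nomax.
have step (i : {i | A i}) : exists j : {i | A i},
    U (sval i) `<=` U (sval j) /\ ~ (U (sval j) `<=` U (sval i)).
  case: i => i Ai /=; apply: contrapT => noj; apply: nomax; exists i => // j Aj ij.
  by apply: contrapT => ji; apply: noj; exists (exist _ j Aj).
have [f fP] := choice step.
pose s n := iter n f (exist _ i0 Ai0).
have [n Un] := noethL (fun n => Usub (sval (s n))) (fun n => (fP (s n)).1).
by have [_] := fP (s n); rewrite -[f _]/(s n.+1) (Un n.+1) //; apply.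
Qed.

End NoetherianModules.

(** * Prime ideals and prime avoidance *)

Section PrimeIdeals.
Variable R : comPzRingType.
Implicit Types (p q : set R) (a b : R).

Lemma prime_idealX q b n : is_prime_ideal q -> q (b ^+ n) -> q b.
Proof.
move=> qP; elim: n => [|n IH]; first by rewrite expr0 => /(prime_ideal1 qP).
by rewrite exprS => /(prime_idealM qP) [|/IH].
Qed.

Lemma prime_idealN q a : is_prime_ideal q -> q a -> q (- a).
Proof. by move=> qP qa; rewrite -mulN1r; exact: prime_idealMl. Qed.

(** Multiply together one element of each [P i] outside [q]. The [P i] will be primes, annihilators
    of coordinates and ideals generated by denominators. *)
Lemma prime_avoid_ideals (I : eqType) (r : seq I) (P : I -> set R) q :
  is_prime_ideal q ->
  (forall i, i \in r -> forall a b, P i b -> P i (a * b)) ->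
  (forall i, i \in r -> ~ P i `<=` q) ->
  exists2 b, ~ q b & forall i, i \in r -> P i b.
Proof.
move=> qP; elim: r => [|i r IH] PM Pq.
  by exists 1 => //; exact: prime_ideal1.
have [j jr|j jr|b qb rb] := IH; first by apply: PM; exact: mem_behead.
  by apply: Pq; exact: mem_behead.
have /existsNP[a /not_implyP[Pa qa]] := Pq i (mem_head _ _).
exists (a * b); first by case/(prime_idealM qP).
move=> j; rewrite inE => /orP[/eqP->|jr].
  by rewrite mulrC; exact: PM (mem_head _ _) _ _ _.
by apply: PM; [exact: mem_behead | exact: rb].
Qed.

End PrimeIdeals.

(** * Associated primes as annihilators, and their finiteness *)

Section Annihilators.
Variables (R : comPzRingType) (L : lmodType R).
Implicit Types (x y : L) (p q : set R) (a b : R).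

Definition ann x : set R := [set a | a *: x = 0].

(** Primes are bare sets here, so that two with the same elements are equal; [AssP] matches this
    description with the socle definition. *)
Definition ass_ideal q := is_prime_ideal q /\ exists x, ann x = q.

Definition max_ass_ideal q :=
  ass_ideal q /\ forall q', ass_ideal q' -> q `<=` q' -> q' = q.

(** The cyclic module on [x] is a copy of the domain [R / q], all of whose nonzero elements have
    annihilator [q]. *)
Lemma annZ x q a : is_prime_ideal q -> ann x = q -> ~ q a -> ann (a *: x) = q.
Proof.
move=> qP xq qa; apply/seteqP; split=> b /=; rewrite /ann /= scalerA.
  by rewrite -[_ = 0]/(ann x (b * a)) xq => /(prime_idealM qP) [].
by rewrite mulrC -scalerA -xq => ->; rewrite scaler0.
Qed.

Lemma submodule_torsion a : submodule [set x : L | a *: x = 0].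
Proof.
apply/submoduleP; split=> [|b x y /= ax ay]; first by rewrite /= scaler0.
by rewrite /= scalerDr ay scalerA mulrC -scalerA ax scaler0 addr0.
Qed.

Hypothesis noethL : noetherian_module L.

(* Choose [r] with [r y != 0] and the kernel of multiplication by [r] maximal. *)
Lemma exists_prime_ann y : y <> 0 -> exists r, is_prime_ideal (ann (r *: y)).
Proof.
move=> y0; have [||r ry rmax] := noetherian_maximal noethL
  (U := fun r => [set x : L | r *: x = 0]) (A := [set r | r *: y <> 0]).
- exact: submodule_torsion.
- by exists 1; rewrite /= scale1r.
exists r; split.
- by rewrite /ann /= scale0r.
- by move=> a b; rewrite /ann /= scalerDl => -> ->; rewrite addr0.
- by move=> a b; rewrite /ann /= -scalerA => ->; rewrite scaler0.
- by rewrite /ann /= scale1r.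
move=> a b; rewrite /ann /= => abry.
have [bry|bry] := pselect (b *: (r *: y) = 0); [by right | left].
(* [b * r] competes with [r] and its kernel contains that of [r], so by maximality the kernels
   agree; [a *: y] lies in the first. *)
have := rmax (b * r); rewrite /= -scalerA => /(_ bry) kerE.
have : ([set x : L | b * r *: x = 0] : set L) (a *: y).
  by rewrite /= -abry !scalerA; congr (_ *: _); ring.
move/kerE => /(_ _)/= <- => [|x /= rx]; first by rewrite !scalerA mulrC.
by rewrite -scalerA rx scaler0.
Qed.

(* Elements whose annihilators are pairwise distinct primes are independent. *)
Lemma finite_ass_ideal : finite_set ass_ideal.
Proof.
apply: contrapT => /infiniteP/pcard_leP[f].
have fA n : ass_ideal (f n) by have := @funS _ _ _ _ f n I.
have fI i j : f i = f j -> i = j by move/inj; rewrite !inE; exact.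
have [x xE] := choice (fun n => (fA n).2).
have indep n (c : nat -> R) : \sum_(i < n) c i *: x i = 0 ->
    forall i, (i < n)%N -> f i (c i).
  elim: n c => // n IH c; rewrite big_ord_recr /= => sum0.
  have fP i : is_prime_ideal (f i) by case: (fA i).
  (* Multiplying the relation by some [b] that kills [x n] removes its last term, and induction
     applies. *)
  have small b i : (i < n)%N -> f n b -> f i (b * c i).
    move=> ltin fnb; apply: (IH (fun i => b * c i) _ i ltin).
    have /(congr1 ( *:%R b)) := sum0; rewrite scalerDr scaler0 scaler_sumr.
    rewrite scalerA mulrC -scalerA -[in f n b]xE in fnb *.
    rewrite (_ : b *: x n = 0) // scaler0 addr0 => {2}<-.
    by apply: eq_bigr => i' _; rewrite scalerA.
  suff fncn : f n (c n).
    move=> i; rewrite ltnS leq_eqVlt => /orP[/eqP->//|ltin].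
    apply: IH ltin; rewrite -xE /ann /= in fncn.
    by move: sum0; rewrite fncn addr0.
  apply: contrapT => ncn.
  (* For [i] in [r], [small] gives [f n] contained in [f i]. The two primes are distinct, so [f i]
     is not contained in [f n], and avoidance yields [b] outside [f n] whose multiple of the
     relation keeps only the last term. *)
  pose r := [seq i <- iota 0 n | ~~ `[< f i (c i) >]].
  have rP i : i \in r -> (i < n)%N /\ ~ f i (c i).
    by rewrite mem_filter mem_iota add0n /= => /andP[/asboolPn].
  have [||b nb rb] := @prime_avoid_ideals R _ r f (f n) (fP n).
  - by move=> i _; exact: prime_idealMl.
  - move=> i /rP[ltin nci] fin; have := ltin; rewrite -(@fI n i) ?ltnn //.
    apply/seteqP; split=> // b fnb.
    by have /(prime_idealM (fP i))[] := small b i ltin fnb.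
  have : f n (b * c n).
    rewrite -[f n]xE /ann /=; have /(congr1 ( *:%R b)) := sum0.
    rewrite scalerDr scaler0 scaler_sumr big1 ?add0r ?scalerA // => i _.
    have [fici|fici] := pselect (f i (c i)).
      by rewrite -xE in fici; rewrite fici scaler0.
    have : f i b by apply: rb; rewrite mem_filter mem_iota /= ltn_ord andbT; apply/asboolPn.
    by rewrite -xE scalerA mulrC -scalerA => ->; rewrite scaler0.
  by case/(prime_idealM (fP n)).
have [n [c [cn sum0]]] := noetherian_dependence noethL x.
apply: (prime_ideal1 (fA n).1); rewrite -cn; exact: indep sum0 n (ltnSn n).
Qed.

End Annihilators.

(** Among the [j] whose set contains [P i], take one with the fewest sets above it; a strictly
    larger set would have fewer still, as [j] itself drops out. *)
Lemma maximal_above (T : finType) (U : Type) (P : T -> set U) i :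
  exists2 j, P i `<=` P j & forall k, P j `<=` P k -> P k = P j.
Proof.
pose up j := #|[pred k | `[< P j `<=` P k >]]|.
have Pii : `[< P i `<=` P i >] by apply/asboolP.
case: (@arg_minnP _ i (fun j => `[< P i `<=` P j >]) up Pii).
move=> j /asboolP ij jmin; exists j => // k jk.
apply/seteqP; split=> //; apply: contrapT => kj.
have := jmin k (asboolT (subset_trans ij jk)); rewrite leqNgt => /negP; apply.
apply: proper_card; apply/properP; split.
  by apply/fintype.subsetP => l /asboolP kl; apply/asboolP/(subset_trans jk).
by exists j; [exact/asboolP | apply/asboolPn].
Qed.

(** * Patching maps that are injective at single primes *)

Section Patching.
Variables (R : comPzRingType) (L L' : lmodType R).
Implicit Types (x : L) (p q : set R) (g f : {linear L -> L'}).

(* For prime [p]: the localization of [g] at [p] is injective. *)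
Definition inj_at p g := forall x, g x = 0 -> exists2 s, ~ p s & s *: x = 0.

(** Unlike [inj_at q], this is unaffected by adding to [g] a multiple [r *: f] with [r] in [q],
    which lets primes be treated one after another. *)
Definition nonvanishing_at q g := forall x, ann x = q -> g x <> 0.

Lemma inj_at_subset p q g : q `<=` p -> inj_at p g -> inj_at q g.
Proof. by move=> qp gp x /gp[s ps sx]; exists s => // /qp. Qed.

Lemma inj_at_nonvanishing q g : inj_at q g -> nonvanishing_at q g.
Proof. by move=> gq x xq /gq[s] /[swap] sx; apply; rewrite -xq. Qed.

Lemma hom_sumE (I : Type) (r : seq I) (P : pred I) (f : I -> {linear L -> L'}) x :
  (\sum_(i <- r | P i) f i) x = \sum_(i <- r | P i) f i x.
Proof. by elim/big_rec2: _ => // i y g _ <-. Qed.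

Variable G : set {linear L -> L'}.
Hypotheses (noethL : noetherian_module L) (submodG : submodule G).

Lemma submoduleD_scale a f g : G f -> G g -> G (g + a *: f).
Proof.
by move=> Gf Gg; rewrite addrC; have [_] := (submoduleP G).1 submodG; apply.
Qed.

(* Since [f] is injective at [q], the "eigenspaces" of [g + r f] for values of
   [r] that are distinct modulo [q] are independent over [R / q]. *)
Lemma exists_nonvanishing_combination q g f (r : nat -> R) :
  is_prime_ideal q -> inj_at q f ->
  (forall m n, (m < n)%N -> ~ q (r n - r m)) ->
  exists n, nonvanishing_at q (g + r n *: f).
Proof.
move=> qP fq rq; apply: contrapT => nogood.
have bad n : exists x, ann x = q /\ g x + r n *: f x = 0.
  apply: contrapT => nox; apply: nogood; exists n => x xq gx.
  by apply: nox; exists x.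
have [x xE] := choice bad.
have indep n (c : nat -> R) : \sum_(i < n) c i *: x i = 0 ->
    forall i, (i < n)%N -> q (c i).
  elim: n c => // n IH c; rewrite big_ord_recr /= => sum0.
  (* [g + r n *: f] kills [x n] and sends each other [x i] to [(r n - r i) *: f (x i)]. Injectivity
     of [f] at [q] then gives a shorter relation, up to a factor [s] outside [q]. *)
  have /fq[s qs] : f (\sum_(i < n) (c i * (r n - r i)) *: x i) = 0.
    have : (g + r n *: f) (\sum_(i < n) c i *: x i + c n *: x n) = 0.
      by rewrite sum0 linear0.
    have xn0 : (g + r n *: f) (x n) = 0 := (xE n).2.
    rewrite linearD [X in _ + X]linearZZ xn0 scaler0 addr0.
    move=> <-; rewrite !linear_sum /=; apply: eq_bigr => i _.
    rewrite !linearZ /= -[RHS]scalerDr.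
    rewrite (_ : g (x i) = - (r i *: f (x i))); last first.
      by apply/eqP; rewrite -addr_eq0 (xE i).2.
    by rewrite [in RHS]addrC -scalerBl scalerA.
  rewrite scaler_sumr => sum1.
  have qc i : (i < n)%N -> q (c i).
    move=> ltin; have : q (s * (c i * (r n - r i))).
      apply: (IH (fun i => s * (c i * (r n - r i)))) ltin; rewrite -[RHS]sum1.
      by apply: eq_bigr => j _; rewrite scalerA.
    by case/(prime_idealM qP) => // /(prime_idealM qP)[|/rq] //; apply.
  move=> i; rewrite ltnS leq_eqVlt => /orP[/eqP->|/qc//].
  rewrite -(xE n).1 /ann /= -[RHS]sum0 big1 ?add0r // => j _.
  by have := qc j (ltn_ord j); rewrite -(xE j).1.
have [n [c [cn sum0]]] := noetherian_dependence noethL x.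
apply: (prime_ideal1 qP); rewrite -cn; exact: indep sum0 n (ltnSn n).
Qed.

Lemma patching :
  (forall p, max_ass_ideal L p -> exists2 g, G g & inj_at p g) ->
  has_injection G.
Proof.
move=> locG.
have [s sE] := (finite_seqP _).1 (finite_ass_ideal noethL).
pose T := seq_sub s; pose P (i : T) := ssval i.
have PA i : ass_ideal L (P i) by rewrite sE /= ssvalP.
have PP i : is_prime_ideal (P i) by case: (PA i).
have AP q : ass_ideal L q -> exists i, P i = q.
  by rewrite sE /= => qs; exists (SeqSub qs).
have PI i j : P i = P j -> i = j by move=> /val_inj.
have above i : exists2 j, P i `<=` P j & max_ass_ideal L (P j).
  have [j ij jmax] := maximal_above P i; exists j => //; split=> //.
  by move=> _ /AP[k <-]; exact: jmax.
(* Injectivity at a maximal associated prime passes down to the primes below it. *)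
have /choice[f fG] i : exists g, G g /\ inj_at (P i) g.
  have [j ij /locG[g Gg gj]] := above i.
  by exists g; split=> //; exact: inj_at_subset gj.
have small (S : {set T}) i : (forall j, j \in S -> ~ P j `<=` P i) ->
    exists2 b, ~ P i b & forall j, j \in S -> P j b.
  move=> Si; have [j _|j|b ib Sb] := @prime_avoid_ideals R _ (enum S) P (P i) (PP i).
  - exact: prime_idealMl.
  - by rewrite mem_enum; exact: Si.
  - by exists b => // j jS; apply: Sb; rewrite mem_enum.
pose S0 : {set T} := finset (fun i => `[< max_ass_ideal L (P i) >]).
have S0P i : reflect (max_ass_ideal L (P i)) (i \in S0).
  by rewrite inE; exact: asboolP.
have good0 : exists2 g, G g & forall i, i \in S0 -> nonvanishing_at (P i) g.
  have /choice[r rP] i : exists b, i \in S0 ->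
      ~ P i b /\ forall j, j \in S0 :\ i -> P j b.
    have [iS|iS] := boolP (i \in S0); last by exists 0.
    have [j|b ib Sb] := small (S0 :\ i) i; last by exists b.
    rewrite !inE => /andP[/eqP ji /asboolP[_ jmax]] /(jmax _ (PA i)) /PI ij.
    by apply: ji.
  exists (\sum_(i in S0) r i *: f i).
    apply: (big_ind G); first by case: ((submoduleP G).1 submodG).
    - by move=> g h Gg Gh; rewrite -[h]scale1r; exact: submoduleD_scale.
    - move=> i _; rewrite -[_ *: _]add0r; apply: submoduleD_scale.
        by case: (fG i).
      by case: ((submoduleP G).1 submodG).
  (* The other [r j] lie in [P i], so their terms vanish on [x], while [r i *: x] still has
     annihilator [P i]. *)
  move=> i iS x xi; rewrite hom_sumE (bigD1 i) //= big1 => [|j /andP[jS ji]].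
    rewrite addr0 -[_ *: _]/(r i *: f i x) -linearZ /=.
    apply: (inj_at_nonvanishing (fG i).2); apply: annZ => //.
    by case: (rP i iS).
  have : P i (r j) by have [_] := rP j jS; apply; rewrite in_setD1 eq_sym ji.
  by rewrite -xi -[X in X = 0]/(r j *: f j x) -linearZ => -> ; rewrite linear0.
(* Since [S] is upward closed, a prime outside it contains no prime of [S], which is what [small]
   asks. *)
have grow k : (k <= #|{: T}|)%N -> exists S : {set T},
    [/\ (k <= #|S|)%N, S0 \subset S,
      (forall i j, i \in S -> P i `<=` P j -> j \in S)
      & exists2 g, G g & forall i, i \in S -> nonvanishing_at (P i) g].
  elim: k => [_|k IH ltk].
    exists S0; split=> // i j /S0P[_ imax] /(imax _ (PA j)) /PI ->.
    by apply/S0P; split.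
  have [S [kS S0S Sup [g Gg gS]]] := IH (ltnW ltk).
  have [ltkS|] := ltnP k #|S|; first by exists S; split=> //; exists g.
  move=> leSk.
  (* A prime outside [S] with the fewest primes above it has all strictly larger ones in [S], so
     adding it keeps [S] upward closed. *)
  pose up j := #|[pred l | `[< P j `<=` P l >]]|.
  have /fintype.subsetPn[i0 _ i0S] : ~~ ([set: T] \subset S)%SET.
    by apply/negP => /subset_leq_card; rewrite cardsT leqNgt (leq_ltn_trans leSk).
  case: (@arg_minnP _ i0 (fun i => i \notin S) up i0S) => i iS imin.
  have upi j : P i `<=` P j -> j != i -> j \in S.
    move=> ij ji; apply/negPn/negP => /imin; rewrite leqNgt => /negP; apply.
    apply: proper_card; apply/properP; split.
      by apply/fintype.subsetP => l /asboolP jl; apply/asboolP/(subset_trans ij).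
    exists i; first exact/asboolP.
    apply/asboolPn => li; case/eqP: ji; apply: PI; exact/seteqP.
  have [j ij jmax] := above i.
  have ji : j != i.
    by apply: contraNneq iS => <-; apply: (fintype.subsetP S0S); exact/S0P.
  have /existsNP[b /not_implyP[jb ib]] : ~ P j `<=` P i.
    by move=> ji'; case/eqP: ji; apply: PI; exact/seteqP.
  have [l lS li|r ir rS] := small S i.
    by move/negP: iS; apply; exact: Sup li.
  (* Here [r] lies in every prime of [S], and [b] in the larger prime [P j], both outside [P i]. If
     [b ^+ (n - m) - 1] were in [P i], it would be in [P j] together with [b], hence so would 1. *)
  have [||n gn] := @exists_nonvanishing_combination (P i) g (f i)
    (fun n => r * b ^+ n) (PP i).
  - by case: (fG i).
  - move=> m n ltmn irb.
    have : P i (r * b ^+ m * (b ^+ (n - m) - 1)).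
      by rewrite mulrBr mulr1 -mulrA -exprD subnKC // ltnW.
    case/(prime_idealM (PP i)) => [/(prime_idealM (PP i))[//|/(prime_idealX (PP i))//]|].
    move=> /ij jb1; apply: (prime_ideal1 (PP j)).
    rewrite -[1](subKr (b ^+ (n - m))); apply: (prime_idealD (PP j)).
      have := subn_gt0 m n; rewrite ltmn; case: (n - m)%N => // d _.
      by rewrite exprSr; exact: (prime_idealMl (PP j)).
    exact: (prime_idealN (PP j)).
  exists (i |: S)%SET; split.
  - by rewrite cardsU1 iS add1n ltnS.
  - exact: fintype.subset_trans S0S (finset.subsetUr _ _).
  - move=> k1 k2; rewrite !in_setU1 => /orP[/eqP->|k1S] k12.
      by case: (eqVneq k2 i) => //= k2i; exact: upi.
    by rewrite (Sup k1) ?orbT.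
  exists (g + (r * b ^+ n) *: f i).
    by apply: submoduleD_scale => //; case: (fG i).
  move=> l; rewrite in_setU1 => /orP[/eqP->//|lS] x xl.
  have lr : P l (r * b ^+ n) by rewrite mulrC; exact: (prime_idealMl (PP l)) (rS l lS).
  rewrite -[X in X <> _]/(g x + (r * b ^+ n) *: f i x) -linearZZ.
  by move: lr; rewrite -{1}xl /ann /= => ->; rewrite linear0 addr0; exact: gS lS x xl.
have [S [TS _ _ [g Gg gS]]] := grow _ (leqnn _).
have ST : S = finset.setT by apply/eqP; rewrite eqEcard finset.subsetT cardsT.
(* A nonzero kernel element would have a multiple with prime annihilator, at which [g] also
   vanishes. *)
exists g => //; apply: raddf_inj => y gy; apply: contrapT => y0.
have [r rP] := exists_prime_ann noethL y0.
have [|i iE] := AP (ann (r *: y)); first by split=> //; exists (r *: y).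
apply: (gS i _ (r *: y)); rewrite ?ST ?finset.in_setT //.
by rewrite linearZZ gy scaler0.
Qed.

End Patching.

(** * Finite powers of a module *)

Section Powers.
Variables (R : comPzRingType) (N : lmodType R) (t : nat).
Local Notation power := {ffun 'I_t -> N}.

(** The chains [V j] of [j]-th coordinates, taken over elements whose earlier coordinates vanish,
    are stationary from a common [n] on. An element of [U m] is then reduced to 0 one coordinate at
    a time by subtracting elements of [U n]. *)
Lemma noetherian_power : noetherian_module N -> noetherian_module power.
Proof.
move=> noethN U Usub Uinc.
have UP n := (submoduleP (U n)).1 (Usub n).
have Umono m n : (m <= n)%N -> U m `<=` U n.
  elim: n => [|n IH]; first by rewrite leqn0 => /eqP->.
  by rewrite leq_eqVlt => /orP[/eqP->//|/IH/subset_trans]; apply; exact: Uinc.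
pose V (j : 'I_t) n :=
  [set v | exists x : power,
     [/\ U n x, forall i : 'I_t, (i < j)%N -> x i = 0 & x j = v]].
have /choice[c cP] (j : 'I_t) : exists n, forall m, (n <= m)%N -> V j m = V j n.
  apply: noethN => [n|n v [x [Ux x0 xj]]]; last by exists x; split=> //; exact: Uinc.
  apply/submoduleP; split.
    by exists 0; split=> [|i _|]; rewrite ?ffunE //; case: (UP n).
  move=> a _ _ [x [Ux x0 <-]] [y [Uy y0 <-]].
  exists (a *: x + y); split=> [|i ij|]; rewrite ?ffunE //; first by case: (UP n) => _; apply.
  by rewrite x0 // y0 // scaler0 addr0.
pose n := \max_j c j; exists n => m nm; apply/seteqP; split; last exact: Umono.
(* [k] bounds the number of trailing coordinates that may be nonzero. *)
suff H k (x : power) : U m x -> (forall i : 'I_t, (i < t - k)%N -> x i = 0) -> U n x.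
  by move=> x Ux; apply: (H t) => // i; rewrite subnn.
elim: k x => [|k IH] x Ux x0.
  rewrite (_ : x = 0); first by case: (UP n).
  by apply/ffunP => i; rewrite ffunE x0 // subn0.
have [tk|kt] := leqP t k.
  by apply: IH => // i; rewrite (eqP tk).
have jt : (t - k.+1 < t)%N by rewrite ltn_subrL (leq_trans _ kt).
pose j := Ordinal jt.
have : V j m (x j) by exists x.
have cn : (c j <= n)%N by exact: leq_bigmax.
rewrite cP ?(leq_trans cn) // -(cP j n) // => -[y [Uy y0 yj]].
rewrite -(subrK y x) -[x - y]scale1r; apply: (UP n).2 => //; apply: IH.
  rewrite addrC -scaleN1r; apply: (UP m).2 => //; exact: Umono Uy.
move=> i; rewrite -subSS subSn // ltnS leq_eqVlt !ffunE => /orP[/eqP ij|ij].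
  by rewrite (_ : i = j) ?yj ?subrr //; exact: val_inj.
by rewrite x0 // y0 // subrr.
Qed.

Lemma ann_power_common p (x : power) : is_prime_ideal p ->
  (forall j, exists2 s, ~ p s & s *: x j = 0) -> exists2 s, ~ p s & s *: x = 0.
Proof.
move=> pP xs.
have [j _ a b|j _|b pb bx] :=
  @prime_avoid_ideals R _ (enum 'I_t) (fun j => ann (x j)) p pP.
- by rewrite /ann /= -scalerA => ->; rewrite scaler0.
- by case: (xs j) => s ps sx /(_ s sx).
by exists b => //; apply/ffunP => j; rewrite !ffunE; apply: bx; rewrite mem_enum.
Qed.

(** Each coordinate of [x] has an annihilator containing [q]; if all were strictly larger, one
    element outside [q] would kill all of [x]. *)
Lemma ass_ideal_power q : ass_ideal power q -> ass_ideal N q.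
Proof.
move=> [qP [x xq]]; split=> //; apply: contrapT => noj.
have [j|s qs sx] := @ann_power_common q x qP; last by apply: qs; rewrite -xq.
apply: contrapT => nos; apply: noj; exists (x j); apply/seteqP; split=> a.
  by move=> /= ax; apply: contrapT => qa; apply: nos; exists a.
by rewrite -xq /ann /= => /ffunP/(_ j); rewrite !ffunE.
Qed.

(** Maximality carries over because a constant vector has the annihilator of its entry, provided [t]
    is positive; the zero module has no associated prime. *)
Lemma max_ass_ideal_power q : max_ass_ideal power q -> max_ass_ideal N q.
Proof.
move=> [qA qmax]; split=> [|q' [q'P [y yq']]]; first exact: ass_ideal_power.
apply: qmax; split=> //; exists [ffun=> y].
have [j0 _] : exists j : 'I_t, True.
  apply: contrapT => noj; case: qA => qP [x xq]; apply: (prime_ideal1 qP).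
  by rewrite -xq; apply/ffunP => j; case: noj; exists j.
rewrite -yq'; apply/seteqP; split=> a; rewrite /ann /=.
  by move=> /ffunP/(_ j0); rewrite !ffunE.
by move=> ay; apply/ffunP => j; rewrite !ffunE.
Qed.

End Powers.

(** * Fractions: vanishing and common denominators *)

Section Localizations.
Variables (R : comPzRingType) (p : prime_spec R) (L : lmodType R).
Implicit Types (x y : L) (s u : den p) (a b : R).

Lemma exists_den a : ~ prime_set p a -> exists u : den p, den_val u = a.
Proof. by move=> pa; exists (Sub a (mem_set pa)); rewrite /den_val SubK. Qed.

Lemma lfrac_eq0 x s : lfrac p x s = 0 <-> exists2 a, ~ prime_set p a & a *: x = 0.
Proof.
rewrite -(lfrac0 L (den1 p)) eq_lfrac den_val1 !scale1r.
split=> [[u]|[a /exists_den[u <-] ux]]; last by exists u; rewrite ux !scaler0.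
by rewrite !scaler0; exists (den_val u) => //; exact: denP.
Qed.

Lemma lfracDs x y s : lfrac p x s + lfrac p y s = lfrac p (x + y) s.
Proof. by rewrite lfracD -scalerDr lfrac_cancel. Qed.

Lemma lfrac_sum (I : Type) (r : seq I) (x : I -> L) s :
  \sum_(i <- r) lfrac p (x i) s = lfrac p (\sum_(i <- r) x i) s.
Proof.
elim: r => [|i r IH]; first by rewrite !big_nil lfrac0.
by rewrite !big_cons IH lfracDs.
Qed.

(** Prime avoidance in the ideals generated by the denominators gives a common multiple outside
    [p]. *)
Lemma common_denominator t (y : {ffun 'I_t -> loc p L}) :
  exists (x : {ffun 'I_t -> L}) s, forall j, y j = lfrac p (x j) s.
Proof.
have /choice[z zP] j : exists z : L * den p, y j = lfrac p z.1 z.2.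
  by have [x [s ->]] := lfracP (y j); exists (x, s).
pose I j := [set a | exists c, a = c * den_val (z j).2].
have [j _ a b [c ->]|j _|b /exists_den[s <-] bI] :=
  @prime_avoid_ideals R _ (enum 'I_t) I p (prime_setP p).
- by exists (a * c); rewrite mulrA.
- by move/(_ (den_val (z j).2)) => /(_ (ex_intro _ 1 (esym (mul1r _))))/denP.
have /choice[c cP] j : exists c, den_val s = c * den_val (z j).2.
  by apply: bI; rewrite mem_enum.
exists [ffun j => c j *: (z j).1], s => j; rewrite ffunE zP.
by apply/eq_lfrac; exists (den1 p); rewrite (cP j) mulrC -scalerA.
Qed.

End Localizations.

(** * Local injections in terms of numerators *)

Section LocalGlobal.
Variables (R : comPzRingType) (N M : lmodType R) (p : prime_spec R).
Variable F : set {linear N -> M}.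

Lemma loc_homE (f : {linear N -> M}) (s r : den p) x :
  (rfrac 1 s *: loc_hom p f : {linear _ -> _}) (lfrac p x r)
  = lfrac p (f x) (denM s r).
Proof.
by rewrite -[LHS]/(rfrac 1 s *: loc_map f (lfrac p x r)) loc_mapE lfracZ scale1r.
Qed.

Lemma loc_homs_injection :
  has_injection (loc_homs p F) <-> exists2 f, F f & inj_at p f.
Proof.
split=> [[_ [f [s [Ff ->]]] finj]|[f Ff fp]].
  exists f => // x fx; apply/(lfrac_eq0 x (den1 p))/finj.
  by rewrite loc_homE fx lfrac0 linear0.
exists (rfrac 1 (den1 p) *: loc_hom p f); first by exists f, (den1 p).
apply: raddf_inj => y; have [x [s ->]] := lfracP y.
move=> /(etrans (esym (loc_homE f (den1 p) s x)))/lfrac_eq0[a pa].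
rewrite -linearZZ => /fp[b pb abx].
apply/lfrac_eq0; exists (b * a); last by rewrite -scalerA.
by case/(prime_idealM (prime_setP p)).
Qed.

Lemma loc_row_homs_injection t :
  has_injection (row_homs (loc_homs p F) t) <->
  exists2 g, row_homs F t g & inj_at p g.
Proof.
split=> [[_ [h [hF ->]] hinj]|[_ [f [fF ->]] fp]].
  have /choice[z zP] j : exists z : {linear N -> M} * den p,
      F z.1 /\ h j = rfrac 1 z.2 *: loc_hom p z.1.
    by have [f [s [Ff hE]]] := hF j; exists (f, s).
  exists (row_hom (fun j => (z j).1)).
    by exists (fun j => (z j).1); split=> // j; case: (zP j).
  move=> x fx; apply: (ann_power_common (prime_setP p)) => j.
  (* Scaling each coordinate by its own denominator cancels the factor in [h j], so [h] takes [y] to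
     the image of [x] under the numerators, which is 0. *)
  pose y := [ffun j => lfrac p (den_val (z j).2 *: x j) (den1 p)].
  have y0 : y = 0.
    apply: hinj; rewrite linear0 -[LHS]/(\sum_j h j (y j)).
    transitivity (\sum_j lfrac p ((z j).1 (x j)) (den1 p)); last first.
      by rewrite lfrac_sum [X in lfrac p X _]fx lfrac0.
    apply: eq_bigr => i _; rewrite ffunE (zP i).2 loc_homE linearZZ.
    exact: lfrac_cancel.
  have : y j = 0 by rewrite y0 ffunE.
  rewrite ffunE => /lfrac_eq0[a pa]; rewrite scalerA => ax.
  by exists (a * den_val (z j).2) => // /(prime_idealM (prime_setP p))[//|/denP].
pose h j := rfrac 1 (den1 p) *: loc_hom p (f j) : {linear _ -> _}.
exists (row_hom h).
  by exists h; split=> // j; exists (f j), (den1 p).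
apply: raddf_inj => y; have [x [s yE]] := common_denominator y.
rewrite -[X in X = 0]/(\sum_j h j (y j)).
under eq_bigr do rewrite yE loc_homE.
rewrite lfrac_sum -[\sum_j _]/(row_hom f x) => /lfrac_eq0[a pa].
rewrite -linearZZ => /fp[b pb abx]; apply/ffunP => j.
rewrite yE ffunE; apply/lfrac_eq0; exists (b * a).
  by case/(prime_idealM (prime_setP p)).
by move/ffunP: abx => /(_ j); rewrite !ffunE scalerA.
Qed.

Lemma loc_col_homs_injection t :
  has_injection (col_homs (loc_homs p F) t) <->
  exists2 g, col_homs F t g & inj_at p g.
Proof.
split=> [[_ [h [hF ->]] hinj]|[_ [f [fF ->]] fp]].
  have /choice[z zP] j : exists z : {linear N -> M} * den p,
      F z.1 /\ h j = rfrac 1 z.2 *: loc_hom p z.1.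
    by have [f [s [Ff hE]]] := hF j; exists (f, s).
  exists (col_hom (fun j => (z j).1)).
    by exists (fun j => (z j).1); split=> // j; case: (zP j).
  move=> x /ffunP fx; apply/(lfrac_eq0 x (den1 p))/hinj; rewrite linear0.
  apply/ffunP => j; have := fx j; rewrite !ffunE (zP j).2 loc_homE => ->.
  exact: lfrac0.
pose h j := rfrac 1 (den1 p) *: loc_hom p (f j) : {linear _ -> _}.
exists (col_hom h).
  by exists h; split=> // j; exists (f j), (den1 p).
apply: raddf_inj => y; have [x [s ->]] := lfracP y => /ffunP hy.
(* Each coordinate of the image is killed by its own element outside [p]; a common one is needed to
   use [fp]. *)
have [j|a pa afx] := @ann_power_common _ _ t p (col_hom f x) (prime_setP p).
  by have := hy j; rewrite !ffunE loc_homE => /lfrac_eq0.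
move: afx; rewrite -linearZZ => /fp[b pb abx]; apply/lfrac_eq0; exists (b * a).
  by case/(prime_idealM (prime_setP p)).
by rewrite -scalerA.
Qed.

End LocalGlobal.

(** * Socles and prime annihilators *)

Section AssociatedPrimes.
Variables (R : comPzRingType) (N : lmodType R).
Hypothesis noethN : noetherian_module N.

(* For the direct implication, given [x / s] in the socle, choose [u] outside
   [p] with maximal kernel on [N]; then [p] is the annihilator of [u x]. *)
Lemma AssP (p : prime_spec R) : Ass N p <-> ass_ideal N p.
Proof.
have pP := prime_setP p; split=> [pA|[_ [x xp]]].
  split=> //.
  have [m pm m0] : exists2 m : loc p N, socle N p m & m <> 0.
    apply: contrapT => nom; apply: pA; apply/seteqP; split=> [m pm|_ ->].
      by apply: contrapT => m0; apply: nom; exists m.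
    by move=> k _; rewrite scaler0.
  have [x [s mE]] := lfracP m; subst m.
  have px a : prime_set p a -> exists2 b, ~ prime_set p b & b *: (a *: x) = 0.
    move=> pa; have : rfrac a (den1 p) *: lfrac p x s = 0.
      by apply: pm; exists a, (den1 p).
    by rewrite lfracZ => /lfrac_eq0.
  have x0 a : ~ prime_set p a -> a *: x <> 0.
    by move=> pa ax; apply: m0; apply/lfrac_eq0; exists a.
  have [||u pu umax] := noetherian_maximal noethN
    (U := fun r => [set y : N | r *: y = 0]) (A := ~` p).
  - exact: submodule_torsion.
  - by exists 1; exact: prime_ideal1.
  exists (u *: x); apply/seteqP; split=> a; rewrite /ann /=.
    move=> aux; apply: contrapT => pa; apply: (x0 (a * u)); last by rewrite -scalerA.
    by case/(prime_idealM pP).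
  move=> /px[v pv vax].
  (* As in [exists_prime_ann], maximality gives [u] and [v * u] the same kernel, which contains
     [a *: x]. *)
  have ker_u : [set y : N | (v * u) *: y = 0] `<=` [set y | u *: y = 0].
    apply: umax => [|y /= uy]; first by case/(prime_idealM pP).
    by rewrite -scalerA uy scaler0.
  rewrite scalerA mulrC -scalerA; apply: ker_u.
  by rewrite /= mulrC -scalerA vax scaler0.
move=> soc0.
have : socle N p (lfrac p x (den1 p)).
  move=> _ [a [s [pa ->]]]; rewrite lfracZ.
  by rewrite -xp in pa; rewrite pa lfrac0.
rewrite soc0 => /lfrac_eq0[a pa ax].
by apply: pa; rewrite -xp.
Qed.

Lemma maxAssP (p : prime_spec R) : maxAss N p <-> max_ass_ideal N p.
Proof.
split=> [[/AssP pA pmax]|[pA pmax]]; split=> //.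
- by move=> q [qP qx]; apply: (pmax (PrimeSpec qP)); exact/AssP.
- exact/AssP.
- by move=> q /AssP; exact: pmax.
Qed.

End AssociatedPrimes.

(** * Suprema and infima of sets of natural numbers *)

Section ExtendedNaturals.
Local Notation enat A := [set (t%:Z%:E : \bar int) | t in A].
Implicit Types (A : set nat) (u : \bar int).

(** On a nonempty set [supremum] picks a least upper bound by [xget]; these are unique, so any one
    found is the value. *)
Lemma supremum_eq (d : Order.disp_t) (X : porderType d) (x0 v : X) (S : set X) :
  S !=set0 -> ubound S v -> lbound (ubound S) v -> supremum x0 S = v.
Proof.
move=> /set0P/negPf S0 Sv vS; rewrite /supremum S0.
by apply: xget_subset1; [split | exact: is_subset1_supremums].
Qed.

Lemma infimum_eq (d : Order.disp_t) (X : porderType d) (x0 v : X) (S : set X) :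
  S !=set0 -> lbound S v -> ubound (lbound S) v -> infimum x0 S = v.
Proof.
move=> /set0P/negPf S0 Sv vS; rewrite /infimum S0.
by apply: xget_subset1; [split | exact: is_subset1_infimums].
Qed.

Lemma infimum_set0 (d : Order.disp_t) (X : porderType d) (x0 : X) :
  infimum x0 set0 = x0.
Proof. by rewrite /infimum eqxx. Qed.

Lemma enat_unbounded u :
  (forall n, exists2 t, (n <= t)%N & (t%:Z%:E <= u)%O) -> u = +oo%E.
Proof.
case: u => [r| |] // nu; last by have [t] := nu 0.
have [t rt] := nu (absz r).+1; rewrite lee_fin => tr; exfalso.
have := le_lt_trans tr (le_lt_trans (ler_norm r) _ : (r < (absz r).+1%:Z)%R).
rewrite -abszE ltz_nat leqnn => /(_ isT); rewrite ltz_nat => tr'.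
by have := leq_ltn_trans rt tr'; rewrite ltnn.
Qed.

Lemma supremum_enat_unbounded A :
  (forall n, exists2 t, (n <= t)%N & A t) -> supremum 0%E (enat A) = +oo%E.
Proof.
move=> Aunb; apply: supremum_eq => [|u _|u uA]; last 1 first.
- suff -> : u = +oo%E by [].
  apply: enat_unbounded => n; have [t nt At] := Aunb n.
  by exists t => //; apply: uA; exists t.
- by have [t _ At] := Aunb 0; exists t%:Z%:E, t.
- exact: leey.
Qed.

Lemma supremum_enat_max A n :
  A n -> (forall t, A t -> (t <= n)%N) -> supremum 0%E (enat A) = n%:Z%:E.
Proof.
move=> An nA; apply: supremum_eq => [|_ [t At <-]|u]; first by exists n%:Z%:E, n.
  by rewrite lee_fin lez_nat nA.
by apply; exists n.
Qed.

(** The bound comes from computing the supremum: [+oo] if [A] is unbounded, its maximum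
    otherwise. *)
Lemma le_supremum_enat A n : A n -> (n%:Z%:E <= supremum 0%E (enat A))%O.
Proof.
move=> An; have [Aunb|] := pselect (forall m, exists2 t, (m <= t)%N & A t).
  by rewrite supremum_enat_unbounded // leey.
move=> /existsNP[m mA]; have Am t : A t -> (t <= m)%N.
  by move=> At; rewrite leqNgt; apply/negP => mt; apply: mA; exists t => //; exact: ltnW.
have exA : exists t, `[< A t >] by exists n; apply/asboolP.
have [k /asboolP Ak kmax] := ex_maxnP exA (fun t At => Am t (asboolW At)).
rewrite (@supremum_enat_max A k) // => [|t At]; last exact/kmax/asboolP.
by rewrite lee_fin lez_nat; exact/kmax/asboolP.
Qed.

Lemma infimum_enat_min A n :
  A n -> (forall t, A t -> (n <= t)%N) -> infimum +oo%E (enat A) = n%:Z%:E.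
Proof.
move=> An nA; apply: infimum_eq => [|_ [t At <-]|u]; first by exists n%:Z%:E, n.
  by rewrite lee_fin lez_nat nA.
by apply; exists n.
Qed.

Lemma infimum_enatP A :
  A = set0 \/ exists n, [/\ A n, forall t, A t -> (n <= t)%N
    & infimum +oo%E (enat A) = n%:Z%:E].
Proof.
have [[n An]|A0] := pselect (exists n, A n); last first.
  by left; apply/seteqP; split=> // n An; apply: A0; exists n.
have exA : exists t, `[< A t >] by exists n; apply/asboolP.
have [k /asboolP Ak kmin] := ex_minnP exA; right; exists k.
have kA t : A t -> (k <= t)%N by move=> At; exact/kmin/asboolP.
by split=> //; exact: infimum_enat_min.
Qed.

Lemma infimum_enat_le A n : A n -> (infimum +oo%E (enat A) <= n%:Z%:E)%O.
Proof.
move=> An; have [A0|[k [_ kA ->]]] := infimum_enatP A; first by rewrite A0 in An.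
by rewrite lee_fin lez_nat kA.
Qed.

Lemma le_infimum_enat A n :
  (forall t, A t -> (n <= t)%N) -> (n%:Z%:E <= infimum +oo%E (enat A))%O.
Proof.
move=> nA; have [->|[k [Ak _ ->]]] := infimum_enatP A.
  by rewrite image_set0 infimum_set0 leey.
by rewrite lee_fin lez_nat nA.
Qed.

Variables (I : Type) (D : set I) (A : set nat) (B : I -> set nat).
Hypothesis AB : forall t, A t <-> forall i, D i -> B i t.

(** [A] is an intersection of initial segments, so the shortest one decides. For empty [D], [A] is
    everything and both sides are [+oo]. *)
Lemma supremum_enat_bigcap :
  (forall i, B i 0) ->
  (forall i m n, (m <= n)%N -> B i n -> B i m) ->
  supremum 0%E (enat A) = infimum +oo%E [set supremum 0%E (enat (B i)) | i in D].
Proof.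
move=> B0 Bdown; have [Aall|] := pselect (forall t, A t).
  rewrite supremum_enat_unbounded => [|n]; last by exists n.
  have Bi i : D i -> supremum 0%E (enat (B i)) = +oo%E.
    move=> Di; apply: supremum_enat_unbounded => n; exists n => //.
    exact: (AB n).1 (Aall n) i Di.
  have [[i Di]|D0] := pselect (exists i, D i).
    apply/esym/infimum_eq => [|_ [j Dj <-]|u _]; last exact: leey.
      by exists (supremum 0%E (enat (B i))), i.
    by rewrite Bi.
  rewrite (_ : [set _ | _ in D] = set0) ?infimum_set0 //.
  apply/seteqP; split=> // _ [i Di <-].
  by apply: D0; exists i.
move=> /existsNP[n0 nA].
have exN : exists n, ~~ `[< A n >] by exists n0; apply/asboolPn.
(* The least number outside [A] is some [n.+1], since every [B i] contains 0; a [B i] missing it has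
   maximum [n], like [A]. *)
case: (ex_minnP exN) => -[|n] /asboolPn An nmin; first by case: An; apply/AB.
have {}nmin : A n.
  by apply: contrapT => /asboolPn /nmin; rewrite ltnn.
have [i /not_implyP[Di Bi]] : exists i, ~ (D i -> B i n.+1).
  by apply/existsNP => /AB.
have ltB t : B i t -> (t <= n)%N.
  by move=> Bt; rewrite leqNgt; apply/negP => /Bdown /(_ Bt).
rewrite (@supremum_enat_max A n) //; last by move=> t At; exact: ltB ((AB t).1 At i Di).
apply/esym/infimum_eq => [|_ [j Dj <-]|u].
- by exists (supremum 0%E (enat (B i))), i.
- by apply: le_supremum_enat; exact: (AB n).1.
rewrite -(@supremum_enat_max (B i) n) //; last exact: (AB n).1.
by apply; exists i.
Qed.

(** Dually, [A] is an intersection of final segments, and the one starting last decides. For empty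
    [D] both sides are 0; for empty [A] the starting points are unbounded or some [B i] is empty. *)
Lemma infimum_enat_bigcap :
  (forall i m n, (m <= n)%N -> B i m -> B i n) ->
  infimum +oo%E (enat A) = supremum 0%E [set infimum +oo%E (enat (B i)) | i in D].
Proof.
move=> Bup.
have notA n : ~ A n -> exists2 i, D i & (n.+1%:Z%:E <= infimum +oo%E (enat (B i)))%O.
  move=> nA; have [i /not_implyP[Di Bi]] : exists i, ~ (D i -> B i n).
    by apply/existsNP => /AB.
  exists i => //; apply: le_infimum_enat => t Bt; rewrite ltnNge; apply/negP => tn.
  exact: Bi (Bup _ _ _ tn Bt).
have [A0|[n [An nA ->]]] := infimum_enatP A.
  rewrite A0 image_set0 infimum_set0; apply/esym/supremum_eq => [|u _|u ubu].
  - have [|i Di _] := notA 0; first by rewrite A0.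
    by exists (infimum +oo%E (enat (B i))), i.
  - exact: leey.
  rewrite (@enat_unbounded u) // => n.
  have [|i Di ni] := notA n; first by rewrite A0.
  exists n.+1 => //; apply: le_trans ni _; apply: ubu; by exists i.
have [[i Di]|D0] := pselect (exists i, D i); last first.
  rewrite (_ : [set _ | _ in D] = set0) ?supremum0; last first.
    by apply/seteqP; split=> // _ [i Di <-]; apply: D0; exists i.
  have : A 0 by apply/AB => i Di; case: D0; exists i.
  by move/nA; rewrite leqn0 => /eqP->.
apply/esym/supremum_eq => [|_ [j Dj <-]|u ubu].
- by exists (infimum +oo%E (enat (B i))), i.
- by apply: infimum_enat_le; exact: (AB n).1.
case: n An nA => [|n] An nA.
  by apply: (@le_trans _ _ (infimum +oo%E (enat (B i)))); [exact: le_infimum_enat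
    | apply: ubu; exists i].
have [|j Dj nj] := notA n; first by move/nA; rewrite ltnn.
by apply: le_trans nj _; apply: ubu; exists j.
Qed.

End ExtendedNaturals.

(** * Rows and columns of maps in [F] *)

Section RowsAndColumns.
Variables (R : comPzRingType) (N M : lmodType R) (F : set {linear N -> M}).

Lemma row_homs0 : has_injection (row_homs F 0).
Proof.
exists (row_hom (fun=> 0)); first by exists (fun=> 0); split=> // -[].
by move=> x y _; apply/ffunP => -[].
Qed.

Lemma row_homs_le m n : (m <= n)%N ->
  has_injection (row_homs F n) -> has_injection (row_homs F m).
Proof.
move=> mn [_ [f [fF ->]] finj].
pose g (j : 'I_m) := f (widen_ord mn j).
exists (row_hom g); first by exists g; split=> // j; exact: fF.
apply: raddf_inj => x gx.
(* [x] padded with zeros, on which [f] takes the value that [g] takes on [x]. *)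
pose y : {ffun 'I_n -> N} := 
  [ffun j : 'I_n => oapp (x : {ffun 'I_m -> N}) 0 (insub (val j))].
have yE (j : 'I_m) : y (widen_ord mn j) = x j by rewrite ffunE /= valK.
have y0 : y = 0.
  apply: finj; rewrite linear0 -[RHS]gx -[LHS]/(\sum_j f j (y j)).
  rewrite -[RHS]/(\sum_j g j (x j)) (bigID (fun j : 'I_n => (j < m)%N)) /=.
  rewrite [X in _ + X]big1 ?addr0.
    rewrite (big_ord_narrow mn); apply: eq_bigr => j _.
    by rewrite yE.
  by move=> j jm; rewrite ffunE insubN // linear0.
by apply/ffunP => j; rewrite -yE y0 !ffunE.
Qed.

Lemma col_homs_le m n : F 0 -> (m <= n)%N ->
  has_injection (col_homs F m) -> has_injection (col_homs F n).
Proof.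
move=> F0 mn [_ [f [fF ->]] finj].
pose g (j : 'I_n) := if insub (val j) is Some i then f i else 0.
exists (col_hom g).
  by exists g; split=> // j; rewrite /g; case: insub => [i|//]; exact: fF.
move=> x y /ffunP gxy; apply: finj; apply/ffunP => j.
by have := gxy (widen_ord mn j); rewrite !ffunE /g /= valK.
Qed.

Hypothesis submodF : submodule F.

Lemma submodule_row_homs t : submodule (row_homs F t).
Proof.
have [F0 Fl] := (submoduleP F).1 submodF; apply/submoduleP; split.
  exists (fun=> 0); split=> //; apply: linear_ext => x.
  by rewrite -[RHS]/(\sum_(j < t) 0 : M) big1.
move=> a _ _ [f [fF ->]] [g [gF ->]].
exists (fun j => a *: f j + g j); split=> [j|]; first exact: Fl.
apply: linear_ext => x.
rewrite -[LHS]/(a *: (\sum_j f j (x j)) + \sum_j g j (x j)).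
by rewrite scaler_sumr -big_split.
Qed.

Lemma submodule_col_homs t : submodule (col_homs F t).
Proof.
have [F0 Fl] := (submoduleP F).1 submodF; apply/submoduleP; split.
  exists (fun=> 0); split=> //; apply: linear_ext => x.
  by apply/ffunP => j; rewrite !ffunE.
move=> a _ _ [f [fF ->]] [g [gF ->]].
exists (fun j => a *: f j + g j); split=> [j|]; first exact: Fl.
by apply: linear_ext => x; apply/ffunP => j; rewrite !ffunE.
Qed.

Lemma loc_homs0 p : loc_homs p F 0.
Proof.
have [F0 _] := (submoduleP F).1 submodF.
exists 0, (den1 p); split=> //; apply: linear_ext => y; have [x [s ->]] := lfracP y.
by rewrite loc_homE lfrac0.
Qed.

End RowsAndColumns.

(** * The local-global principle over a set of primes *)

Section LocalGlobalPrinciple.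
Variables (R : comPzRingType) (N : lmodType R) (D : set (prime_spec R)).
Hypothesis maxD : maxAss N `<=` D.

(** [G] will be [F] or its rows or columns of length [t], and [locG p] the existence of a local
    injection. A global injection is injective at every prime; the converse is [patching]. *)
Lemma injection_local_global (L L' : lmodType R) (G : set {linear L -> L'})
    (locG : prime_spec R -> Prop) :
  noetherian_module N -> noetherian_module L ->
  max_ass_ideal L `<=` max_ass_ideal N -> submodule G ->
  (forall p, locG p <-> exists2 g, G g & inj_at p g) ->
  has_injection G <-> forall p, D p -> locG p.
Proof.
move=> noethN noethL LN submodG locGP; split=> [[g Gg ginj] p _|locD].
  apply/locGP; exists g => // x gx; exists 1; first exact: prime_ideal1 (prime_setP p).
  by rewrite scale1r; apply: ginj; rewrite gx linear0.
apply: patching => // p pL.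
have /locD/locGP// : D (PrimeSpec pL.1.1).
by apply: maxD; apply/(maxAssP noethN); exact: LN.
Qed.

Variables (M : lmodType R) (F : set {linear N -> M}).
Hypotheses (noethN : noetherian_module N) (submodF : submodule F).

(** A length [t] works globally exactly when it works at every prime of [D], which turns the
    invariants into an infimum and a supremum. Leaving [D] general covers both [Ass N] and
    [maxAss N]. *)
Lemma invariants_local_global :
  [/\ inj_capacity F
        = infimum +oo%E [set inj_capacity (loc_homs p F) | p in D],
      num_cogenerators F
        = supremum 0%E [set num_cogenerators (loc_homs p F) | p in D] &
      has_injection F
        <-> (forall p, D p -> has_injection (loc_homs p F))].
Proof.
split.
- apply: supremum_enat_bigcap => [t|p|p m n]; last exact: row_homs_le.
    apply: injection_local_global => //.
    + exact: noetherian_power.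
    + exact: max_ass_ideal_power.
    + exact: submodule_row_homs.
    + by move=> p; exact: loc_row_homs_injection.
  exact: row_homs0.
- apply: infimum_enat_bigcap => [t|p m n]; last by apply: col_homs_le; exact: loc_homs0.
  apply: injection_local_global => //; first exact: submodule_col_homs.
  by move=> p; exact: loc_col_homs_injection.
- apply: injection_local_global => // p; exact: loc_homs_injection.
Qed.

End LocalGlobalPrinciple.

Theorem theorem4p6 (R : comPzRingType) (M N : lmodType R)
    (F : set {linear N -> M})
    (noethN : noetherian_module N) (submodF : submodule F) :
  [/\ inj_capacity F
        = infimum +oo%E [set inj_capacity (loc_homs p F) | p in Ass N],
      num_cogenerators F
        = supremum 0%E [set num_cogenerators (loc_homs p F) | p in Ass N] &
      has_injection F
        <-> (forall p, Ass N p -> has_injection (loc_homs p F))] /\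
  [/\ inj_capacity F
        = infimum +oo%E [set inj_capacity (loc_homs p F) | p in maxAss N],
      num_cogenerators F
        = supremum 0%E [set num_cogenerators (loc_homs p F) | p in maxAss N] &
      has_injection F
        <-> (forall p, maxAss N p -> has_injection (loc_homs p F))].
Proof. by split; apply: invariants_local_global => // p []. Qed.
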